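(* Let $V$ be a compact convex set in $\mathbb{R}^n$, let $S_V^{\mathbb{R}^n}(t)=\sum_{0\le k\le n}s_k^{\mathbb{R}^n}(V)t^k$ be its Steiner polynomial, and let $q\in\{0,1,2,\dots\}$. Then the $q$-th adjoint Steiner polynomial of $V$ is $$S_{V\times0^q}^{\mathbb{R}^{n+q}}(t)=\sum_{0\le k\le n}s_k^{\mathbb{R}^n}(V)\,\gamma_k^{(q)}\,t^{k+q},\qquad\text{where}\quad \gamma_k^{(q)}=\pi^{q/2}\,\frac{\Gamma(\frac k2+1)}{\Gamma(\frac{k+q}{2}+1)}.$$
   Context: $B^m$ is the closed unit ball of $\mathbb{R}^m$. For a compact convex set $K\subset\mathbb{R}^m$, the Steiner polynomial $S_K^{\mathbb{R}^m}$ is the polynomial satisfying $S_K^{\mathbb{R}^m}(t)=\mathrm{Vol}_m(K+tB^m)$ for all real $t\ge0$. For $V\subset\mathbb{R}^n$, $V\times0^q\subset\mathbb{R}^{n}\times\mathbb{R}^q=\mathbb{R}^{n+q}$ is the Cartesian product of $V$ with the origin $0^q$ of $\mathbb{R}^q$ (with $V\times0^0=V$); its Steiner polynomial with respect to $\mathbb{R}^{n+q}$ is called the $q$-th adjoint Steiner polynomial of $V$. *)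

(* Defs.v *)
From HB Require Import structures.
From mathcomp Require Import all_boot all_order all_algebra.
From mathcomp Require Import all_classical all_reals all_analysis.

Set Implicit Arguments.
Unset Strict Implicit.
Unset Printing Implicit Defensive.

Import Order.TTheory GRing.Theory Num.Theory.
Import numFieldNormedType.Exports.

Local Open Scope classical_set_scope.
Local Open Scope ring_scope.

(* n-fold product of the one-dimensional Lebesgue measure, along the
   identification R^(n+1) = R^n * R. *)
Fixpoint lebesgue_tuple (R : realType) (n : nat) :
    set (n.-tuple (measurableTypeR R)) -> \bar R :=
  match n with
  | 0 => \d_[tuple]
  | m.+1 => pushforward
      (@lebesgue_tuple R m \x^ (@lebesgue_measure R))%E
      (fun p : m.-tuple (measurableTypeR R) * measurableTypeR R =>
         [tuple of rcons p.1 p.2])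
  end.

(* Row vectors carry no sigma-algebra in the library, hence the transport. *)
Definition volume (R : realType) (n : nat) (A : set 'rV[R]_n) : \bar R :=
  @lebesgue_tuple R n
    ((fun t : n.-tuple (measurableTypeR R) => \row_(i < n) tnth t i) @^-1` A).

(* The library norm of 'rV[R]_n is the sup norm, so the Euclidean ball is
   spelled out. *)
Definition unit_ball (R : realType) (n : nat) : set 'rV[R]_n :=
  [set x | Num.sqrt (\sum_(i < n) x ord0 i ^+ 2) <= 1].

Definition minkowski_sum (R : realType) (n : nat) (A B : set 'rV[R]_n) :
    set 'rV[R]_n :=
  [set x + y | x in A & y in B].

Definition dilate (R : realType) (n : nat) (t : R) (A : set 'rV[R]_n) :
    set 'rV[R]_n :=
  [set t *: x | x in A].

Definition is_steiner_poly (R : realType) (n : nat) (K : set 'rV[R]_n)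
    (S : {poly R}) : Prop :=
  forall t : R, 0 <= t ->
    volume (minkowski_sum K (dilate t (@unit_ball R n))) = (S.[t])%:E.

Lemma is_steiner_poly_unique (R : realType) (n : nat) (K : set 'rV[R]_n)
    (S S' : {poly R}) :
  is_steiner_poly K S -> is_steiner_poly K S' -> S = S'.
Proof.
move=> hS hS'; apply/eqP; rewrite -subr_eq0; apply/eqP.
set d := S - S'.
apply: (@roots_geq_poly_eq0 R d [seq i%:R | i <- iota 0 (size d)]).
- apply/allP => x /mapP[i _ ->].
  have i0 : 0 <= i%:R :> R by [].
  have := hS _ i0; rewrite (hS' _ i0) => -[e].
  by rewrite rootE /d hornerD hornerN e subrr.
- by rewrite map_inj_uniq ?iota_uniq//; exact: mulrIn.
- by rewrite size_map size_iota.
Qed.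

Definition times_origin (R : realType) (n q : nat) (V : set 'rV[R]_n) :
    set 'rV[R]_(n + q) :=
  [set row_mx v (0 : 'rV[R]_q) | v in V].

Arguments times_origin {R n} q V _.

Definition Gamma (R : realType) (x : R) : R :=
  (\int[@lebesgue_measure R]_(t in `]0%R, +oo[) (t `^ (x - 1) * expR (- t)))%R.

Definition adjoint_factor (R : realType) (q k : nat) : R :=
  pi `^ (q%:R / 2) * (Gamma (k%:R / 2 + 1) / Gamma ((k + q)%:R / 2 + 1)).

(* Main.v *)
(* Slice the parallel body of V x 0^(q+1) at height y in the last coordinate: it
   is the parallel body of V x 0^q with radius sqrt(t^2 - y^2) if |y| <= t, and
   empty otherwise. Hence passing from q to q+1 replaces each monomial t^m by
     int_(-t)^t sqrt(t^2 - y^2)^m dy = t^(m+1) int_(-pi/2)^(pi/2) cos^(m+1),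
   and Wallis' and Euler's recursions show that the last integral is
   sqrt(pi) Gamma(m/2 + 1) / Gamma((m+1)/2 + 1), i.e. the quotient of
   consecutive adjoint factors. Coefficients of S beyond degree n vanish since
   the parallel body of V lies in a cube of side O(t). *)

Require Import Defs.
From mathcomp Require Import all_boot all_order all_algebra.
From mathcomp Require Import all_classical all_reals all_analysis.
From mathcomp Require Import measurable_realfun polyrcf lra ring.

Set Implicit Arguments.
Unset Strict Implicit.
Unset Printing Implicit Defensive.

Import Order.TTheory GRing.Theory Num.Theory.
Import numFieldNormedType.Exports.
Import gauss_integral_proof.

Local Open Scope classical_set_scope.
Local Open Scope ring_scope.

(** * Iterated Lebesgue integrals over sets of sequences *)

(* No measurability is assumed: the volume of a slice is not known to depend
   measurably on its height. *)
Lemma le_integralT_ge0 d (T : measurableType d) (R : realType)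
    (mu : {measure set T -> \bar R}) (f g : T -> \bar R) :
  (forall x, 0 <= f x)%E -> (forall x, f x <= g x)%E ->
  (\int[mu]_x f x <= \int[mu]_x g x)%E.
Proof.
move=> f0 fg.
have g0 x : (0 <= g x)%E by exact: le_trans (f0 x) (fg x).
(* The integral of a nonnegative function is a supremum over the simple functions below it, and
   those below [f] also lie below [g]. *)
rewrite !ge0_integralTE//; apply: ereal_sup_le => _ [h /= hf <-].
by exists h => // x; exact: le_trans (hf x) (fg x).
Qed.

(** Unfolds the product: the last coordinate is the outer variable. Since sets are given by
    predicates on sequences, a slice is again such a set, and inductions on the dimension go through
    for arbitrary [P]. *)
Lemma lebesgue_tupleS (R : realType) m (P : set (seq R)) :
  @lebesgue_tuple R m.+1 [set s | P (tval s)] =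
  (\int[@lebesgue_measure R]_y
     @lebesgue_tuple R m [set s | P (rcons (tval s) y)])%E.
Proof.
rewrite /= /pushforward /product_measure2; apply: eq_integral => y _ /=.
by congr (lebesgue_tuple _); apply/seteqP; split => s /=; rewrite /ysection/= inE.
Qed.

Lemma lebesgue_tuple0 (R : realType) (P : set (seq R)) :
  @lebesgue_tuple R 0 [set s | P (tval s)] = (\1_P [::])%:E.
Proof. by rewrite /= diracE indicE. Qed.

Lemma lebesgue_tuple_ge0 (R : realType) m (P : set (seq R)) :
  (0 <= @lebesgue_tuple R m [set s | P (tval s)])%E.
Proof.
elim: m P => [|m IH] P; first by rewrite lebesgue_tuple0 lee_fin indicE.
by rewrite lebesgue_tupleS integral_ge0// => y _; exact: (IH (fun s => P (rcons s y))).
Qed.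

Lemma le_lebesgue_tuple (R : realType) m (P Q : set (seq R)) :
  (forall s, size s = m -> P s -> Q s) ->
  (@lebesgue_tuple R m [set s | P (tval s)] <=
   @lebesgue_tuple R m [set s | Q (tval s)])%E.
Proof.
elim: m P Q => [|m IH] P Q PQ.
  rewrite !lebesgue_tuple0 lee_fin !indicE ler_nat.
  case: (boolP ([::] \in P)) => //.
  by rewrite inE => /PQ-/(_ erefl); rewrite -in_setE => ->.
rewrite !lebesgue_tupleS; apply: le_integralT_ge0 => y.
  exact: (@lebesgue_tuple_ge0 R m (fun s => P (rcons s y))).
apply: (IH (fun s => P (rcons s y)) (fun s => Q (rcons s y))) => s sm.
by apply: PQ; rewrite size_rcons sm.
Qed.

Lemma lebesgue_tuple_set0 (R : realType) m :
  @lebesgue_tuple R m set0 = 0%E.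
Proof.
elim: m => [|m IH]; first by rewrite (lebesgue_tuple0 (@set0 (seq R))) indic0.
rewrite (lebesgue_tupleS m (@set0 (seq R))) -[RHS](integral0 lebesgue_measure setT).
by apply: eq_integral => y _; exact: IH.
Qed.

Lemma lebesgue_tuple_cube (R : realType) m (c : R) : 0 <= c ->
  @lebesgue_tuple R m [set s | all (fun x => `|x| <= c) (tval s)] =
  ((2 * c) ^+ m)%:E.
Proof.
move=> c0; elim: m => [|m IH].
  by rewrite (lebesgue_tuple0 (fun s => all _ s)) indicE/= mem_set.
rewrite (lebesgue_tupleS m (fun s => all _ s)).
transitivity (\int[@lebesgue_measure R]_y
    ((cst ((2 * c) ^+ m)%:E \_ `[(- c)%R, c]) y))%E.
  apply: eq_integral => y _; rewrite patchE.
  have -> : (y \in [set` `[- c, c]]) = (`|y| <= c).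
    by apply/idP/idP; rewrite inE /= in_itv/= -ler_norml.
  case: ifPn => yc.
    rewrite -[in RHS]IH; congr (lebesgue_tuple _).
    by apply/seteqP; split => s /=; rewrite all_rcons yc.
  apply: (etrans _ (lebesgue_tuple_set0 R m)); congr (lebesgue_tuple _).
  by apply/seteqP; split => s //=; rewrite all_rcons (negbTE yc).
rewrite -integral_mkcond integral_cst//= lebesgue_measure_itv/= lte_fin.
(* The length formula for an interval distinguishes nondegenerate from degenerate endpoints; the
   latter forces [c = 0]. *)
have [cc|cc] := ltP (- c) c; first by rewrite -EFinB -EFinM exprS; congr EFin; ring.
have -> : c = 0 by lra.
by rewrite mule0 mulr0 exprS mul0r.
Qed.

(** * Wallis integrals and powers of the half-chord *)

(** The integral of $\cos^k$ over $[-\pi/2,\pi/2]$, by Wallis' recursion. *)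
Fixpoint cos_moment (R : realType) (k : nat) : R :=
  match k with
  | 0 => pi
  | 1 => 2
  | m.+2 => m.+1%:R / m.+2%:R * cos_moment R m
  end.

Lemma nat_ind2 (P : nat -> Prop) :
  P 0 -> P 1 -> (forall k, P k -> P k.+2) -> forall k, P k.
Proof.
move=> P0 P1 PS k; suff : P k /\ P k.+1 by case.
by elim: k => [|k [Pk PSk]]; split => //; exact: PS.
Qed.

Lemma is_derive1_exprn (R : realType) (f : R -> R) n (x df : R) :
  is_derive x 1 f df ->
  is_derive x 1 (fun y => f y ^+ n) (n%:R * f x ^+ n.-1 * df).
Proof. by move=> dfx; have := is_deriveX n dfx; rewrite exprfctE. Qed.

(** Reduction formula on primitives: $(k+2)F_{k+2} = (k+1)F_k + \sin\cos^{k+1}$. The last term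
    vanishes at $\pm\pi/2$, which leaves Wallis' recursion. *)
Lemma cos_exp_primitive (R : realType) k : exists F : R -> R,
  (forall x : R, is_derive x 1 F (cos x ^+ k)) /\
  F (pi / 2) - F (- (pi / 2)) = cos_moment R k.
Proof.
elim/nat_ind2: k => [||k [F [dF FE]]].
- exists id; split => /=; last by field.
  by move=> x; rewrite expr0; exact: is_derive_id.
- exists sin; split; last by rewrite sinN sin_pihalf /=; ring.
  by move=> x; rewrite expr1; exact: is_derive_sin.
- exists (fun x => k.+2%:R^-1 * (k.+1%:R * F x + sin x * cos x ^+ k.+1)).
  split => [x|]; last first.
    by rewrite cosN cos_pihalf/= -FE expr0n /=; field; rewrite -natr1 ?pnatr_eq0.
  have dc := is_derive1_exprn k.+1 (is_derive_cos x).
  apply: is_derive_eq.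
  rewrite /GRing.scale/= mulrN mulrN (mulrC (sin x)) -mulrA -expr2 sin2cos2 !exprS.
  by field; rewrite -natrD pnatr_eq0.
Qed.

Lemma continuous_cos_exp (R : realType) k : continuous (fun x : R => cos x ^+ k).
Proof.
move=> x; apply: (@continuous_comp _ _ _ cos (fun z : R => z ^+ k)).
  exact: continuous_cos.
exact: exprn_continuous.
Qed.

Lemma continuous_sqrt_exp (R : realType) k (t : R) :
  continuous (fun y : R => Num.sqrt (t ^+ 2 - y ^+ 2) ^+ k).
Proof.
move=> y; apply: (@continuous_comp _ _ _
  (fun y : R => Num.sqrt (t ^+ 2 - y ^+ 2)) (fun z : R => z ^+ k)); last first.
  exact: exprn_continuous.
apply: (@continuous_comp _ _ _ (fun y : R => t ^+ 2 - y ^+ 2) Num.sqrt).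
  by apply: cvgB; [exact: cvg_cst|exact: exprn_continuous].
exact: sqrt_continuous.
Qed.

Lemma integral_cos_exp (R : realType) k :
  (\int[@lebesgue_measure R]_(x in `[(- (pi / 2))%R, (pi / 2)%R]) (cos x ^+ k)%:E =
   (cos_moment R k)%:E)%E.
Proof.
have [F [dF <-]] := cos_exp_primitive R k.
have cF x : {for x, continuous F}.
  by apply: differentiable_continuous; apply/derivable1_diffP; exact: ex_derive.
rewrite (@continuous_FTC2 _ _ F)//.
- by rewrite -subr_gt0 opprK addr_gt0// divr_gt0// pi_gt0.
- exact/continuous_subspaceT/continuous_cos_exp.
- split.
  + by move=> x _; exact: ex_derive.
  + by apply: cvg_at_right_filter; exact: cF.
  + by apply: cvg_at_left_filter; exact: cF.
- by move=> x _; rewrite derive1E derive_val.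
Qed.

(** Substitute $y = t\sin x$: the root becomes $t\cos x$, and the derivative contributes one more
    factor $t\cos x$. *)
Lemma integral_sqrt_exp (R : realType) k (t : R) : 0 <= t ->
  (\int[@lebesgue_measure R]_(y in `[(- t)%R, t]) (Num.sqrt (t ^+ 2 - y ^+ 2) ^+ k)%:E
   = (cos_moment R k.+1 * t ^+ k.+1)%:E)%E.
Proof.
(* For [t = 0] the substitution is not strictly increasing; the interval is then a single point. *)
rewrite le_eqVlt => /predU1P[<-|t0].
  by rewrite oppr0 set_itv1 integral_set1 exprS mul0r mulr0.
have p0 : - (pi / 2) <= pi / 2 :> R.
  by rewrite -subr_ge0 opprK addr_ge0// divr_ge0// pi_ge0.
pose F (x : R) := t * sin x.
have dF (x : R) : is_derive x 1 F (t * cos x).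
  by apply: is_derive_eq; rewrite /GRing.scale/= ?mul0r ?addr0 ?mulr1.
have F'E : derive1 F = fun x => t * cos x.
  by apply/funext => x; rewrite derive1E derive_val.
have cF' x : {for x, continuous (derive1 F)}.
  rewrite F'E; apply: cvgM; [exact: cvg_cst|exact: continuous_cos].
have cF x : {for x, continuous F}.
  by apply: differentiable_continuous; apply/derivable1_diffP; exact: ex_derive.
have -> : t = F (pi / 2) by rewrite /F sin_pihalf mulr1.
have -> : - F (pi / 2) = F (- (pi / 2)) by rewrite /F sinN mulrN.
rewrite (@integration_by_substitution_increasing _ F
    (fun y => Num.sqrt (F (pi / 2) ^+ 2 - y ^+ 2) ^+ k)) //; last first.
- exact/continuous_subspaceT/continuous_sqrt_exp.
- split.
  + by move=> x _; exact: ex_derive.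
  + by apply: cvg_at_right_filter; exact: cF.
  + by apply: cvg_at_left_filter; exact: cF.
- by apply/cvg_ex; eexists; apply: cvg_at_left_filter; exact: cF'.
- by apply/cvg_ex; eexists; apply: cvg_at_right_filter; exact: cF'.
- by move=> x _; exact: cF'.
- by move=> x y xI yI xy; rewrite ltr_pM2l// ltr_sin.
rewrite [F (pi / 2)]/F sin_pihalf mulr1 EFinM -integral_cos_exp.
rewrite -ge0_integralZr//.
- apply: eq_integral => x; rewrite inE/= in_itv/= => xI.
  rewrite F'E -EFinM; congr EFin => /=.
  (* The cosine is nonnegative on this interval, so the root of $(t\cos x)^2$ carries no absolute
     value. *)
  have c0 : 0 <= cos x by exact: cos_ge0_pihalf.
  rewrite /F [LHS]/=; change (Num.sqrt (t ^+ 2 - (t * sin x) ^+ 2) ^+ k * (t * cos x)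
    = cos x ^+ k.+1 * t ^+ k.+1).
  have -> : t ^+ 2 - (t * sin x) ^+ 2 = (t * cos x) ^+ 2.
    by rewrite !exprMn sin2cos2; ring.
  by rewrite sqrtr_sqr ger0_norm ?mulr_ge0// 1?ltW// exprMn !exprS; ring.
- apply/measurable_EFinP/measurable_funTS => //.
  apply: continuous_measurable_fun; exact: continuous_cos_exp.
- move=> x xI; rewrite lee_fin exprn_ge0//; exact: (cos_ge0_pihalf xI).
- by rewrite lee_fin exprn_ge0// ltW.
Qed.

(** * The Gamma function at integers and half-integers *)

(** The values $\Gamma(m/2+1)$, from $\Gamma(1)=1$, $\Gamma(3/2)=\sqrt\pi/2$ and Euler's
    recursion. *)
Fixpoint half_fact (R : realType) (m : nat) : R :=
  match m with
  | 0 => 1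
  | 1 => Num.sqrt pi / 2
  | k.+2 => k.+2%:R / 2 * half_fact R k
  end.

(** Makes the boundary terms at infinity vanish. For $x\ge1$ one has $\sqrt x^m\le x^m$ and $e^x\ge
    x^{m+1}/(m+1)!$, so the product is at most $(m+1)!/x$. *)
Lemma cvg_sqrt_exp_expRN (R : realType) m :
  (Num.sqrt x ^+ m * expR (- x)) @[x --> +oo] --> (0 : R).
Proof.
have cvg_inv : (m.+1`!%:R * x^-1) @[x --> +oo] --> (0 : R).
  rewrite -[0](mulr0 m.+1`!%:R); apply: cvgMr.
  by apply/gtr0_cvgV0; [near=> x|exact: cvg_id].
apply: (squeeze_cvgr _ (cvg_cst 0) cvg_inv).
near=> x.
have x1 : 1 <= x by near: x; exact: nbhs_pinfty_ge.
have x0 : 0 < x by exact: lt_le_trans x1.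
apply/andP; split; first by rewrite mulr_ge0 ?exprn_ge0 ?sqrtr_ge0 ?expR_ge0.
have sx : Num.sqrt x <= x.
  by rewrite -[leRHS](ger0_norm (ltW x0)) -sqrtr_sqr ler_wsqrtr// expr2 ler_peMl// ltW.
rewrite expRN ler_pdivrMr ?expR_gt0//.
apply: (@le_trans _ _ (x ^+ m)); first by apply: lerXn2r; rewrite ?nnegrE ?sqrtr_ge0// ltW.
have f0 : 0 < m.+1`!%:R :> R by rewrite ltr0n fact_gt0.
apply: (@le_trans _ _ (m.+1`!%:R * x^-1 * (x ^+ m.+1 / m.+1`!%:R))).
  by rewrite exprS le_eqVlt; apply/orP; left; apply/eqP; field; rewrite !gt_eqF.
rewrite ler_pM2l ?mulr_gt0 ?invr_gt0//.
by apply: le_trans (expR_ge1Dxn m (ltW x0)); rewrite lerDr.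
Unshelve. all: by end_near. Qed.

Lemma is_derive1_sqrt_exp (R : realType) m (x : R) : 0 < x ->
  is_derive x 1 (fun y => Num.sqrt y ^+ m.+2) (m.+2%:R / 2 * Num.sqrt x ^+ m).
Proof.
move=> x0; have dsqrt := is_derive1_sqrt x0.
apply: (is_derive_eq (is_derive1_exprn m.+2 dsqrt)).
have s0 : Num.sqrt x != 0 by rewrite sqrtr_eq0 -ltNge.
by rewrite /= exprS; field.
Qed.

Lemma is_derive1_expRN (R : realType) (x : R) :
  is_derive x 1 (fun y => expR (- y)) (- expR (- x)).
Proof.
have := @is_derive1_comp R expR -%R x (expR (- x)) (-1).
rewrite mulrN1; apply.
Qed.

Lemma continuous_sqrt_exp_expRN (R : realType) m :
  continuous (fun x : R => Num.sqrt x ^+ m * expR (- x)).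
Proof.
move=> x; apply: (@cvgM _ _ _ _ (fun x => Num.sqrt x ^+ m) (fun x => expR (- x))).
  apply: (@continuous_comp _ _ _ Num.sqrt (fun z : R => z ^+ m)).
    exact: sqrt_continuous.
  exact: exprn_continuous.
by apply: (@continuous_comp _ _ _ -%R expR); [exact: continuousN|exact: continuous_expR].
Qed.

(** The square of this nonnegative integral tends to $\pi/4$; take square roots. *)
Lemma cvg_integral0_gauss (R : realType) :
  @integral0_gauss R x @[x --> +oo] --> Num.sqrt pi / 2.
Proof.
have -> : Num.sqrt pi / 2 = Num.sqrt (pi / 4 : R).
  rewrite sqrtrM ?pi_ge0// sqrtrV// (_ : 4 = 2 ^+ 2); last by rewrite -natrX.
  by rewrite sqrtr_sqr ger0_norm.
have : Num.sqrt (@integral0_gauss R x ^+ 2) @[x --> +oo] --> Num.sqrt (pi / 4).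
  by apply: continuous_cvg; [exact: sqrt_continuous|exact: cvg_integral0_gauss_sqr].
apply: cvg_trans; apply: near_eq_cvg; near=> x.
by rewrite /= sqrtr_sqr ger0_norm// integral0_gauss_ge0.
Unshelve. all: by end_near. Qed.

Lemma is_derive1_integral0_gauss (R : realType) (x : R) : 0 < x ->
  is_derive x 1 (@integral0_gauss R) (gauss_fun x).
Proof.
move=> x0; have x1 : x < x + 1 by rewrite ltrDl.
have intg : lebesgue_measure.-integrable `[0, x + 1] (EFin \o @gauss_fun R).
  apply: continuous_compact_integrable; first exact: segment_compact.
  by apply: continuous_subspaceT; exact: continuous_gauss_fun.
have [d dE] := continuous_FTC1_closed x1 intg x0 (@continuous_gauss_fun R x).
by apply: DeriveDef; [exact: d|rewrite -derive1E; exact: dE].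
Qed.

Lemma cvg0_integral0_gauss (R : realType) :
  @integral0_gauss R x @[x --> 0^'+] --> (0 : R).
Proof.
have intg : lebesgue_measure.-integrable `[0, 1] (EFin \o @gauss_fun R).
  apply: continuous_compact_integrable; first exact: segment_compact.
  by apply: continuous_subspaceT; exact: continuous_gauss_fun.
have := parameterized_integral_continuous (@ler01 R) intg.
move=> /(continuous_within_itvP _ (@ltr01 R))[_ + _].
by rewrite /parameterized_integral set_itv1 Rintegral_set1.
Qed.

Lemma cvgy_sqrt (R : realType) : Num.sqrt (x : R) @[x --> +oo] --> +oo.
Proof.
apply/cvgryPge => A; near=> x.
have Ax : A ^+ 2 <= x by near: x; apply: nbhs_pinfty_ge; exact: num_real.
apply: (le_trans (ler_norm A)); rewrite -sqrtr_sqr ler_wsqrtr//.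
Unshelve. all: by end_near. Qed.

Lemma cvg_at_right_sqrt (R : realType) :
  Num.sqrt x @[x --> (0:R)^'+] --> (0:R)^'+.
Proof.
move=> P [e /= e0 eP]; change (\forall x \near (0:R)^'+, P (Num.sqrt x)).
near=> x; apply: eP => /=; last first.
  by rewrite sqrtr_gt0; near: x; exact: nbhs_right_gt.
rewrite sub0r normrN ger0_norm ?sqrtr_ge0// -(gtr0_norm e0) -sqrtr_sqr.
rewrite ltr_sqrt ?exprn_gt0//; near: x; apply: nbhs_right_lt.
by rewrite exprn_gt0.
Unshelve. all: by end_near. Qed.

(* Euler's recursion [Gamma (x + 1) = x Gamma x], carried out on primitives of
   the integrand so that no integrability has to be established beforehand. *)
Lemma half_gamma_primitive (R : realType) m : exists F : R -> R,
  [/\ forall x : R, 0 < x -> is_derive x 1 F (Num.sqrt x ^+ m * expR (- x)),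
      F x @[x --> 0^'+] --> F 0, F 0 = 0
    & F x @[x --> +oo] --> half_fact R m].
Proof.
elim/nat_ind2: m => [||m [F [dF F0 FE Fy]]].
- exists (fun x => 1 - expR (- x)); split.
  + move=> x _; have d := is_derive1_expRN x.
    by apply: is_derive_eq; rewrite expr0; ring.
  + apply: cvg_at_right_filter; apply: cvgB; first exact: cvg_cst.
    by apply: (@continuous_comp _ _ _ -%R expR);
      [exact: continuousN|exact: continuous_expR].
  + by rewrite oppr0 expR0 subrr.
  + by rewrite /= -[X in _ --> X]subr0; apply: cvgB; [exact: cvg_cst|exact: cvgr_expR].
- have I0 : integral0_gauss (0 : R) = 0.
    by rewrite /integral0_gauss set_itv1 Rintegral_set1.
  (* Integration by parts leaves $e^{-x}/(2\sqrt x)$, whose primitive under $x=u^2$ is the Gauss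
     integral up to $\sqrt x$. *)
  exists (fun x => integral0_gauss (Num.sqrt x) - Num.sqrt x ^+ 1 * expR (- x)); split.
  + move=> x x0; have s0 : 0 < Num.sqrt x by rewrite sqrtr_gt0.
    have dE := is_derive1_expRN x; have dS := is_derive1_sqrt x0.
    have dI := is_derive1_comp (is_derive1_integral0_gauss s0) dS.
    have dM := is_deriveM dS dE.
    rewrite expr1; apply: (is_derive_eq (is_deriveB dI dM)).
    rewrite /gauss_fun sqr_sqrtr 1?ltW// /GRing.scale/=.
    by field; rewrite gt_eqF.
  + rewrite [in integral0_gauss _]sqrtr0 I0; apply: cvgB.
      exact: cvg_comp (@cvg_at_right_sqrt R) (@cvg0_integral0_gauss R).
    apply: cvg_at_right_filter; exact: continuous_sqrt_exp_expRN.
  + by rewrite sqrtr0 I0 expr1 mul0r subrr.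
  + rewrite -[X in _ --> X]subr0; apply: cvgB; last exact: cvg_sqrt_exp_expRN.
    exact: cvg_comp (@cvgy_sqrt R) (@cvg_integral0_gauss R).
(* Integration by parts, differentiating $x^{(m+2)/2}$; the boundary term vanishes at both ends. *)
- exists (fun x => m.+2%:R / 2 * F x - Num.sqrt x ^+ m.+2 * expR (- x)); split.
  + move=> x x0; have dFx := dF _ x0; have dE := is_derive1_expRN x.
    have dS := is_derive1_sqrt_exp m x0.
    have dM := is_deriveM dS dE.
    apply: (is_derive_eq (is_deriveB (is_deriveZ (m.+2%:R / 2) dFx) dM)).
    by rewrite /GRing.scale/=; ring.
  + apply: cvgB; first exact: cvgMr.
    apply: cvg_at_right_filter; exact: continuous_sqrt_exp_expRN.
  + by rewrite FE sqrtr0 expr0n mulr0 mul0r subrr.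
  + rewrite -[X in _ --> X]subr0; apply: cvgB; last exact: cvg_sqrt_exp_expRN.
    exact: cvgMr.
Qed.

Lemma Gamma_half (R : realType) m : Gamma (m%:R / 2 + 1 : R) = half_fact R m.
Proof.
have [F [dF F0 FE Fy]] := half_gamma_primitive R m.
rewrite /Gamma addrK -[RHS]subr0 -[X in _ - X]FE.
rewrite -(@Rintegral_ge0_continuous_FTC2y _
  (fun x => Num.sqrt x ^+ m * expR (- x)) F 0 _ _ _ Fy _ F0).
(* For $x>0$ the real power $x^{m/2}$ is $\sqrt x^m$; adding the endpoint 0 then leaves the integral
   unchanged. *)
- transitivity (\int[lebesgue_measure]_(x in `]0%R, +oo[)
    (Num.sqrt x ^+ m * expR (- x) : R)).
    apply: eq_Rintegral => x; rewrite inE/= in_itv/= andbT => x0.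
    by rewrite (mulrC m%:R) powRrM powR12_sqrt ?ltW// powR_mulrn ?sqrtr_ge0.
  rewrite /Rintegral integral_itv_obnd_cbnd//.
  apply/measurable_EFinP/measurable_funTS => //.
  apply: continuous_measurable_fun; exact: continuous_sqrt_exp_expRN.
- by move=> x x0; rewrite mulr_ge0 ?exprn_ge0 ?sqrtr_ge0 ?expR_ge0.
- exact/continuous_subspaceT/continuous_sqrt_exp_expRN.
- by move=> x x0; have dFx := dF _ x0; exact: ex_derive.
- move=> x; rewrite in_itv/= andbT => x0; have := dF _ x0 => dFx.
  by rewrite derive1E derive_val.
Qed.

(** Wallis' factor $(m+2)/(m+3)$ times Euler's factor $(m+3)/2$ is $(m+2)/2$, Euler's factor on the
    right; so both sides obey the same two-step recursion. *)
Lemma cos_moment_half_fact (R : realType) m :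
  cos_moment R m.+1 * half_fact R m.+1 = Num.sqrt pi * half_fact R m.
Proof.
elim/nat_ind2: m => [||m IH].
- by rewrite /=; field.
- by rewrite /= -[X in 1 / 2 * X](sqr_sqrtr (pi_ge0 R)); field.
- change (m.+2%:R / m.+3%:R * cos_moment R m.+1 *
    (m.+3%:R / 2 * half_fact R m.+1) =
    Num.sqrt pi * (m.+2%:R / 2 * half_fact R m)).
  by rewrite [RHS]mulrCA -IH; field; rewrite -natrD pnatr_eq0.
Qed.

Lemma half_fact_gt0 (R : realType) m : 0 < half_fact R m.
Proof.
elim/nat_ind2: m => [||m IH] /=; first exact: ltr01.
  by rewrite divr_gt0// sqrtr_gt0 pi_gt0.
by rewrite mulr_gt0// divr_gt0.
Qed.

(** * Parallel bodies and their slices *)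

Lemma minkowski_dilateP (R : realType) n (K : set 'rV[R]_n) (t : R)
    (x : 'rV[R]_n) : 0 <= t ->
  minkowski_sum K (dilate t (@unit_ball R n)) x <->
  exists2 v, K v & \sum_(i < n) (x ord0 i - v ord0 i) ^+ 2 <= t ^+ 2.
Proof.
move=> t0; split.
  move=> [v Kv] [_ [b /= b1 <-] <-]; exists v => //.
  under eq_bigr do rewrite !mxE addrAC subrr add0r exprMn.
  rewrite -mulr_sumr ler_piMr ?sqr_ge0//.
  by rewrite -(@ler_sqrt _ _ 1)// sqrtr1.
move=> [v Kv xv]; exists v => //; exists (x - v); last by rewrite addrC subrK.
(* The point of the ball is $(x-v)/t$; for [t = 0] the bound forces [x = v], and the centre serves
   instead. *)
have [t_eq0|t_neq0] := eqVneq t 0.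
  exists 0; first by rewrite /unit_ball/= big1 ?sqrtr0 ?ler01// => i _; rewrite mxE expr0n.
  rewrite t_eq0 scale0r; apply/rowP => i; rewrite !mxE; apply/eqP.
  rewrite eq_sym -sqrf_eq0; move: xv; rewrite t_eq0 expr0n/= => xv.
  have /eqP := le_anti (introT andP (conj xv (sumr_ge0 _ (fun i _ => sqr_ge0 _)))).
  by rewrite psumr_eq0 => [/allP/(_ i (mem_index_enum i))|j _]; rewrite ?sqr_ge0.
exists (t^-1 *: (x - v)); last by rewrite scalerA mulfV// scale1r.
rewrite /unit_ball/= -sqrtr1 ler_wsqrtr//.
under eq_bigr do rewrite !mxE exprMn.
rewrite -mulr_sumr exprVn ler_pdivrMl ?mulr1//.
by rewrite exprn_gt0// lt_neqAle eq_sym t_neq0.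
Qed.

(* Points are sequences rather than tuples, so that the dimensions [n + q.+1]
   and [(n + q).+1] need no cast. *)
Definition parallel_body (R : realType) n (V : set 'rV[R]_n) q (t : R) :
    set (seq R) :=
  [set s | exists2 v, V v &
    \sum_(i < n) (s`_i - v ord0 i) ^+ 2 + \sum_(j < q) s`_(n + j) ^+ 2
      <= t ^+ 2].

Lemma volume_parallel_body (R : realType) n (V : set 'rV[R]_n) (t : R) :
  0 <= t ->
  volume (minkowski_sum V (dilate t (@unit_ball R n))) =
  @lebesgue_tuple R n [set s | parallel_body V 0 t (tval s)].
Proof.
move=> t0; congr (lebesgue_tuple _); apply/seteqP; split => s.
  move=> /(minkowski_dilateP _ _ t0)[v Vv vs]; exists v => //.
  rewrite big_ord0 addr0; apply: le_trans vs.
  by under [leRHS]eq_bigr do rewrite mxE (tnth_nth 0).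
move=> [v Vv]; rewrite big_ord0 addr0 => vs.
apply/(minkowski_dilateP _ _ t0); exists v => //.
by under eq_bigr do rewrite mxE (tnth_nth 0).
Qed.

(** The last [q] coordinates of a point of $V\times0^q$ are zero, so the squared distance splits
    into the two sums of [parallel_body]. *)
Lemma volume_times_origin (R : realType) n q (V : set 'rV[R]_n) (t : R) :
  0 <= t ->
  volume (minkowski_sum (times_origin q V) (dilate t (@unit_ball R (n + q)))) =
  @lebesgue_tuple R (n + q) [set s | parallel_body V q t (tval s)].
Proof.
move=> t0; have dE (s : (n + q).-tuple R) (v : 'rV[R]_n) :
  \sum_(i < n + q) ((\row_i tnth s i) ord0 i - row_mx v 0 ord0 i) ^+ 2 =
  \sum_(i < n) ((tval s)`_i - v ord0 i) ^+ 2 +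
  \sum_(j < q) (tval s)`_(n + j) ^+ 2.
  rewrite big_split_ord; congr (_ + _); apply: eq_bigr => i _.
    by rewrite mxE row_mxEl (tnth_nth 0).
  by rewrite mxE row_mxEr mxE subr0 (tnth_nth 0).
congr (lebesgue_tuple _); apply/seteqP; split => s.
  move=> /(minkowski_dilateP _ _ t0)[_ [v Vv <-] vs]; exists v => //.
  by rewrite -dE.
move=> [v Vv vs]; apply/(minkowski_dilateP _ _ t0).
by exists (row_mx v 0); [exists v|rewrite dE].
Qed.

(** The new coordinate adds [y ^+ 2] to the squared distance. The condition on [|y|] is stated apart
    because [Num.sqrt] is 0 on negative numbers, which would give radius 0 instead of an empty
    slice. *)
Lemma parallel_body_rcons (R : realType) n q (V : set 'rV[R]_n) (t y : R)
    (s : seq R) : 0 <= t -> size s = (n + q)%N ->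
  parallel_body V q.+1 t (rcons s y) <->
  `|y| <= t /\ parallel_body V q (Num.sqrt (t ^+ 2 - y ^+ 2)) s.
Proof.
move=> t0 sz; have yt : (`|y| <= t) = (0 <= t ^+ 2 - y ^+ 2).
  by rewrite subr_ge0 -[y ^+ 2]real_normK ?num_real// ler_sqr.
have dE (v : 'rV[R]_n) :
  \sum_(i < n) ((rcons s y)`_i - v ord0 i) ^+ 2 +
  \sum_(j < q.+1) (rcons s y)`_(n + j) ^+ 2 =
  \sum_(i < n) (s`_i - v ord0 i) ^+ 2 +
  \sum_(j < q) s`_(n + j) ^+ 2 + y ^+ 2.
  rewrite big_ord_recr/= addrA; congr (_ + _ + _ ^+ 2).
  - apply: eq_bigr => i _.
    by rewrite nth_rcons sz (leq_trans (ltn_ord i) (leq_addr _ _)).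
  - by apply: eq_bigr => i _; rewrite nth_rcons sz ltn_add2l ltn_ord.
  - by rewrite nth_rcons sz ltnn eqxx.
rewrite yt; split.
  move=> [v Vv]; rewrite dE -lerBrDr => vs.
  have yt0 : 0 <= t ^+ 2 - y ^+ 2.
    by apply: le_trans vs; rewrite addr_ge0// sumr_ge0// => i _; rewrite sqr_ge0.
  by split => //; exists v => //; rewrite sqr_sqrtr.
move=> [yt0 [v Vv]]; rewrite sqr_sqrtr// => vs.
by exists v => //; rewrite dE -lerBrDr.
Qed.

(** * Adjoint factors and induction on the codimension *)

Lemma adjoint_factor0 (R : realType) k : adjoint_factor R 0 k = 1.
Proof.
rewrite /adjoint_factor addn0 mul0r powRr0 mul1r divff//.
by rewrite Gamma_half gt_eqF// half_fact_gt0.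
Qed.

(** The quotient of consecutive factors is
    $\sqrt\pi\,\Gamma(\frac{k+q}2+1)/\Gamma(\frac{k+q+1}2+1)$, a Wallis integral by
    [cos_moment_half_fact]. *)
Lemma adjoint_factorS (R : realType) q k :
  adjoint_factor R q.+1 k = adjoint_factor R q k * cos_moment R (k + q).+1.
Proof.
rewrite /adjoint_factor addnS !Gamma_half.
have -> : (pi : R) `^ (q.+1%:R / 2) = pi `^ (q%:R / 2) * Num.sqrt pi.
  rewrite -powR12_sqrt ?pi_ge0// -powRD; last by rewrite (gt_eqF (pi_gt0 R)) implybT.
  by congr (_ `^ _); rewrite -natr1; field.
have hf := half_fact_gt0 R.
have -> : cos_moment R (k + q).+1 =
    Num.sqrt pi * half_fact R (k + q) / half_fact R (k + q).+1.
  by rewrite -cos_moment_half_fact mulfK// gt_eqF.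
by field; rewrite !gt_eqF.
Qed.

Lemma lebesgue_tuple_parallel_body (R : realType) n q (V : set 'rV[R]_n)
    (c : nat -> R) :
  (forall t, 0 <= t -> @lebesgue_tuple R n [set s | parallel_body V 0 t (tval s)] =
    (\sum_(k < n.+1) c k * t ^+ k)%:E) ->
  forall t, 0 <= t ->
    @lebesgue_tuple R (n + q) [set s | parallel_body V q t (tval s)] =
    (\sum_(k < n.+1) c k * adjoint_factor R q k * t ^+ (k + q))%:E.
Proof.
(* The radius stays general in the induction, since the slice at height [y] has its own radius. *)
move=> H0; elim: q => [|q IH] t t0.
  rewrite addn0 H0//; congr EFin; apply: eq_bigr => k _.
  by rewrite adjoint_factor0 mulr1 addn0.
rewrite addnS (lebesgue_tupleS (n + q) (parallel_body V q.+1 t)).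
pose f k y : \bar R := (c k * adjoint_factor R q k *
  Num.sqrt (t ^+ 2 - y ^+ 2) ^+ (k + q))%:E.
(* The induction hypothesis makes the slice volume a continuous function on $[-t,t]$, and empty
   slices give zero outside; integration then proceeds term by term. *)
transitivity (\int[@lebesgue_measure R]_y
    (((fun y => \sum_(k < n.+1) f k y) \_ `[(- t)%R, t]) y))%E.
  apply: eq_integral => y _; rewrite patchE.
  have -> : (y \in [set` `[- t, t]]) = (`|y| <= t).
    by apply/idP/idP; rewrite inE /= in_itv/= -ler_norml.
  case: ifPn => yt.
    rewrite sumEFin -IH ?sqrtr_ge0//; congr (lebesgue_tuple _).
    apply/seteqP; split => s /=.
      by move=> /(parallel_body_rcons _ _ t0 (size_tuple s))[].
    by move=> ps; apply/(parallel_body_rcons _ _ t0 (size_tuple s)).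
  apply: (etrans _ (lebesgue_tuple_set0 R (n + q))); congr (lebesgue_tuple _).
  apply/seteqP; split => s //= /(parallel_body_rcons _ _ t0 (size_tuple s))[].
  by rewrite (negbTE yt).
rewrite -integral_mkcond integral_sum//; last first.
  move=> k; apply: continuous_compact_integrable; first exact: segment_compact.
  apply: continuous_subspaceT => y; apply: cvgMr.
  exact: continuous_sqrt_exp.
rewrite -sumEFin; apply: eq_bigr => k _.
rewrite /f; under eq_integral do rewrite EFinM.
rewrite integralZl//; last first.
  apply: continuous_compact_integrable; first exact: segment_compact.
  by apply: continuous_subspaceT; exact: continuous_sqrt_exp.
by rewrite integral_sqrt_exp// adjoint_factorS -EFinM addnS !mulrA.
Qed.

(** * Degree bound for the Steiner polynomial *)

(** If the degree of [p] exceeded [n], then [p] and [p - r] would share their leading coefficient. A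
    negative one makes [p] negative far out, a positive one makes [p] exceed the bound [r]. *)
Lemma poly_le_exp_coef0 (R : realType) n (p : {poly R}) (b : R) :
  (forall t, 0 <= t -> 0 <= p.[t] <= (2 * (b + t)) ^+ n) ->
  forall k, (n < k)%N -> p`_k = 0.
Proof.
move=> pb; pose r : {poly R} := (2 *: ('X + b%:P)) ^+ n.
have rE t : r.[t] = (2 * (b + t)) ^+ n.
  by rewrite /r horner_exp hornerZ hornerD hornerX hornerC addrC.
have sr : (size r <= n.+1)%N.
  apply: leq_trans (size_exp_leq _ _) _; rewrite ltnS.
  rewrite -[leqRHS]mul1n leq_mul2r; apply/orP; right.
  by rewrite size_scale ?pnatr_eq0// size_XaddC.
have [sp|sp] := leqP (size p) n.+1.
  by move=> k nk; rewrite nth_default// (leq_trans sp).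
exfalso.
have lr : lead_coef (p - r) = lead_coef p.
  by rewrite lead_coefDl// size_polyN (leq_ltn_trans sr).
have p0 : lead_coef p != 0 by rewrite lead_coef_eq0 -size_poly_gt0 (leq_ltn_trans _ sp).
have [lp|lp|lp] := ltgtP (lead_coef p) 0; last by rewrite lp eqxx in p0.
- have [m Hm] : exists m, forall x, x >= m -> (- p).[x] >= lead_coef (- p).
    by apply: poly_pinfty_gt_lc; rewrite lead_coefN oppr_gt0.
  (* The point must lie beyond the threshold [m] and also be nonnegative for [pb] to apply. *)
  have := Hm (Num.max m 0); rewrite le_max lexx/= => /(_ isT).
  have /andP[h _] := pb (Num.max m 0) ltac:(by rewrite le_max lexx orbT).
  rewrite hornerN lead_coefN lerNl opprK => /(le_trans h).
  by rewrite leNgt lp.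
- have [m Hm] : exists m, forall x, x >= m -> (p - r).[x] >= lead_coef (p - r).
    by apply: poly_pinfty_gt_lc; rewrite lr.
  have := Hm (Num.max m 0); rewrite le_max lexx/= => /(_ isT).
  have /andP[_ h] := pb (Num.max m 0) ltac:(by rewrite le_max lexx orbT).
  rewrite hornerD hornerN rE lr => H.
  by have := lt_le_trans lp H; rewrite subr_gt0 ltNge h.
Qed.

Lemma steiner_coef0 (R : realType) n (V : set 'rV[R]_n) (S : {poly R}) :
  compact V -> is_steiner_poly V S -> forall k, (n < k)%N -> S`_k = 0.
Proof.
move=> cV HS.
have [b b0 Vb] : exists2 b : R, 0 <= b & forall v, V v -> forall i, `|v ord0 i| <= b.
  have [M [_ MV]] := compact_bounded cV.
  (* Boundedness holds for every constant strictly above [M]; this one is also nonnegative. *)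
  exists (`|M| + 1); first by rewrite addr_ge0.
  move=> v Vv i; have /= := MV (`|M| + 1) _ v Vv.
  rewrite (le_lt_trans (ler_norm M)) ?ltrDl// => /(_ isT); apply: le_trans.
  rewrite /Num.norm/= mx_normrE.
  exact: (@le_bigmax _ _ _ _ (fun ij : 'I_1 * 'I_n => `|v ij.1 ij.2|) (ord0, i)).
apply: (@poly_le_exp_coef0 R n S b) => t t0.
rewrite -!lee_fin -HS// volume_parallel_body//; apply/andP; split.
  exact: lebesgue_tuple_ge0.
rewrite -lebesgue_tuple_cube ?addr_ge0//.
apply: (le_lebesgue_tuple (P := parallel_body V 0 t)
  (Q := fun s => all (fun x => `|x| <= b + t) s)) => s sz [v Vv].
rewrite big_ord0 addr0 => vs; apply/(all_nthP 0) => i; rewrite sz => ltin.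
pose j := Ordinal ltin.
(* One coordinate difference is at most the Euclidean distance, so the body lies in the cube
   $|x_i|\le b+t$. *)
have sv : (s`_i - v ord0 j) ^+ 2 <= t ^+ 2.
  apply: le_trans vs; rewrite (bigD1 j)//= lerDl sumr_ge0// => k _.
  exact: sqr_ge0.
have {}sv : `|s`_i - v ord0 j| <= t.
  by rewrite -ler_sqr ?nnegrE// real_normK ?num_real.
rewrite -[s`_i](subrK (v ord0 j)) addrC (le_trans (ler_normD _ _))//.
by rewrite lerD// Vb.
Qed.

Theorem theorem11p3 (R : realType) (n q : nat) (V : set 'rV[R]_n)
    (S : {poly R}) (compactV : compact V) (convexV : convex_set V)
    (steinerS : is_steiner_poly V S) :
  is_steiner_poly (times_origin q V)
    (\sum_(k < n.+1) (S`_k * adjoint_factor R q k) *: 'X^(k + q)).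
Proof.
move=> t t0; rewrite volume_times_origin//.
rewrite (@lebesgue_tuple_parallel_body _ _ _ _ (fun k => S`_k))//.
  congr EFin; rewrite horner_sum; apply: eq_bigr => k _.
  by rewrite hornerZ hornerXn.
move=> u u0; rewrite -volume_parallel_body// steinerS//; congr EFin.
(* The base case [q = 0] needs [S] written as a sum of exactly the terms up to degree [n]. *)
have S_size : (size S <= n.+1)%N.
  by apply/leq_sizeP => k nk; exact: (steiner_coef0 compactV steinerS).
by rewrite (horner_coef_wide _ S_size).
Qed.
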